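(* Let $0<\varepsilon<1$ and let $n,s$ be positive integers with $n\geq 2s+2$. Let $X$ be the maximum number of edges in a subgraph $F$ of the random graph $G(n,p)$ with $\nu(F)\leq s$. If $p\geq \frac{250\log n}{\varepsilon^2 n}$, then with probability at least $1-2n^{-s}$, $$(1-\varepsilon)p\max\left\{\binom{2s+1}{2},\binom{s}{2}+s(n-s)\right\}\le X\le (1+\varepsilon)p\max\left\{\binom{2s+1}{2},\binom{s}{2}+s(n-s)\right\}.$$
   Context: $G(n,p)$ is the Erdős–Rényi random graph on vertex set $[n]$ in which each pair is an edge independently with probability $p$. $\nu(F)$ denotes the matching number of a graph $F$, the maximum number of pairwise disjoint edges. $\log$ is the natural logarithm. *)

(* Defs.v *)
From mathcomp Require Export all_boot all_order all_algebra.
From mathcomp Require Export reals exp.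

Set Implicit Arguments.
Unset Strict Implicit.
Unset Printing Implicit Defensive.

Import GRing.Theory.

Local Open Scope ring_scope.

(* A simple graph on the vertex set T is represented by its edge set, a set of
   2-element subsets of T.  Isolated vertices affect neither the number of
   edges nor the matching number, so a subgraph is a subset of the edge set. *)
Definition pairs (T : finType) : {set {set T}} := [set e : {set T} | #|e| == 2].

Definition matching_number (T : finType) (F : {set {set T}}) : nat :=
  \max_(M : {set {set T}} | (M \subset F) && trivIset M) #|M|.

Definition max_edges_nu_le (T : finType) (s : nat) (G : {set {set T}}) : nat :=
  \max_(F : {set {set T}} | (F \subset G) && (matching_number F <= s)%N) #|F|.

(* G(n, p) is the product of Bernoulli(p) measures over the pairs of vertices,
   an element G of the sample space powerset (pairs 'I_n) being the set of
   pairs that are edges. *)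
Definition gnp_weight (R : realType) (n : nat) (p : R)
    (G : {set {set 'I_n}}) : R :=
  \prod_(e in pairs 'I_n) (if e \in G then p else 1 - p).

Definition gnp_prob (R : realType) (n : nat) (p : R)
    (A : pred {set {set 'I_n}}) : R :=
  \sum_(G in powerset (pairs 'I_n) | A G) gnp_weight p G.

(* The edges are independent, each of probability p. *)
Lemma gnp_prob_subset (R : realType) (n : nat) (p : R) (S : {set {set 'I_n}}) :
  S \subset pairs 'I_n -> gnp_prob p (fun G => S \subset G) = p ^+ #|S|.
Proof.
move=> sSP; pose P := pairs 'I_n.
pose f e : R := if e \in P then p else 0.
pose g e : R := if e \in P then (if e \in S then 0 else 1 - p) else 1.
have -> : p ^+ #|S| = \prod_e (f e + g e).
  rewrite (bigID (mem S)) /= [X in _ * X]big1 ?mulr1.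
    rewrite -prodr_const; apply: eq_bigr => e eS.
    by rewrite /f /g (subsetP sSP e eS) eS addr0.
  move=> e eNS; rewrite /f /g (negbTE eNS); case: ifP => _; last by rewrite add0r.
  by rewrite addrC subrK.
rewrite bigA_distr /gnp_prob big_mkcond; apply: eq_bigr => G _ /=.
rewrite powersetE; case: ifP => [/andP[sGP sSG]|].
  rewrite /gnp_weight big_mkcond; apply: eq_bigr => e _.
  rewrite /f /g -/P; case: (boolP (e \in P)) => eP.
    case: (boolP (e \in G)) => // eNG.
    by case: (boolP (e \in S)) => // /(subsetP sSG); rewrite (negbTE eNG).
  by case: (boolP (e \in G)) => // /(subsetP sGP); rewrite (negbTE eP).
case: (boolP (G \subset _)) => [_ /= /negbT /subsetPn[e eS eNG]|].
  rewrite (bigD1 e) //= (negbTE eNG) /g (subsetP sSP e eS) eS.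
  by rewrite mul0r.
move=> /subsetPn[e eG eNP] _.
by rewrite (bigD1 e) //= eG /f (negbTE eNP) mul0r.
Qed.

Lemma gnp_probT (R : realType) (n : nat) (p : R) :
  gnp_prob p (fun _ : {set {set 'I_n}} => true) = 1.
Proof.
rewrite -[RHS](expr0 p) -(cards0 {set 'I_n}) -gnp_prob_subset ?sub0set //.
by apply: eq_bigl => G; rewrite sub0set.
Qed.

(* Main.v *)
Require Import Defs.
From mathcomp Require Import zify ring lra sequences.

(** Write [m] for the extremal number, and call two vertices equivalent when no
    maximum matching of [F] misses both. If every vertex is missed by some
    maximum matching, this relation is transitive (Gallai); its classes contain
    all edges of [F] and each of them has at most one vertex missed by a given
    maximum matching. Deleting the vertices met by all maximum matchings one at
    a time, one finds a vertex set [U] and a partition of the vertices into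
    parts [S] with [|U| + sum |S|/2 <= nu(F)] such that every edge of [F] meets
    [U] or lies in a part. The graph of all such pairs is a container of [F];
    when [nu(F) <= s] it has at most [m] edges by convexity in [|U|], and there
    are at most [n^(6s)] containers since [U] and the partition are coded by
    [2s] pairs of vertices.

    By Chernoff, [G(n, p)] has more than [(1 + eps) p m] edges in a given
    container with probability at most [exp(- eps^2 p m / 6) <= n^(-7s)], as
    [2 m >= s n]; a union bound over the containers gives the upper bound, and
    the lower tail for one extremal graph gives the lower bound. *)

Set Implicit Arguments.
Unset Strict Implicit.
Unset Printing Implicit Defensive.

(** * Covering a graph by vertices and classes *)

Lemma matching_numberP (T : finType) (F : {set {set T}}) :
  exists2 M : {set {set T}}, (M \subset F) && trivIset M & #|M| = matching_number F.
Proof.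
have p0 : ((set0 : {set {set T}}) \subset F) && trivIset (set0 : {set {set T}}).
  by rewrite sub0set; apply/trivIsetP => A B; rewrite inE.
rewrite /matching_number (@bigop.bigmax_eq_arg _ set0
  (fun M : {set {set T}} => (M \subset F) && trivIset M) _ p0) //.
by case: arg_maxnP => // M pM _; exists M.
Qed.

Lemma leq_matching_number (T : finType) (F M : {set {set T}}) :
  M \subset F -> trivIset M -> #|M| <= matching_number F.
Proof.
move=> sMF tM; rewrite /matching_number.
apply: (@bigop.leq_bigmax_cond _
  (fun M : {set {set T}} => (M \subset F) && trivIset M) (fun M => #|M|)).
by rewrite sMF.
Qed.

Definition max_matching (T : finType) (F M : {set {set T}}) : bool :=
  [&& M \subset F, trivIset M & #|M| == matching_number F].

(** The disjunct [u == v] provides reflexivity: a vertex missed by some maximum matching fails the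
    second condition against itself. *)
Definition never_both_missed (T : finType) (F : {set {set T}}) : rel T :=
  fun u v => (u == v) ||
    [forall M, max_matching F M ==> ((u \in cover M) || (v \in cover M))].

Lemma card_cover_matching (T : finType) (M : {set {set T}}) :
  M \subset pairs T -> trivIset M -> #|cover M| = 2 * #|M|.
Proof.
move=> sMP /eqP <-; rewrite mulnC -sum_nat_const; apply: eq_bigr => e eM.
by have := subsetP sMP e eM; rewrite inE => /eqP.
Qed.

Lemma trivIset_mem_eq (T : finType) (M : {set {set T}}) (e f : {set T}) x :
  trivIset M -> e \in M -> f \in M -> x \in e -> x \in f -> e = f.
Proof.
move=> /trivIsetP tM eM fM xe xf; apply/eqP/negPn/negP => nef.
by have /pred0P/(_ x) := tM e f eM fM nef; rewrite /= xe xf.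
Qed.

Lemma mem_cover (T : finType) (M : {set {set T}}) e x :
  e \in M -> x \in e -> x \in cover M.
Proof. by move=> eM xe; apply/bigcupP; exists e. Qed.

Lemma trivIset_setU1 (T : finType) (M : {set {set T}}) (e : {set T}) :
  trivIset M -> {in M, forall f : {set T}, [disjoint e & f]} -> trivIset (e |: M).
Proof.
move=> /trivIsetP tM de; apply/trivIsetP => A B /setU1P[->|AM] /setU1P[->|BM].
- by rewrite eqxx.
- by move=> _; apply: de.
- by move=> _; rewrite disjoint_sym; apply: de.
- exact: tM.
Qed.

Lemma pair_other (T : finType) (e : {set T}) x y :
  #|e| = 2 -> x \in e -> y \in e -> x != y -> e = [set x; y].
Proof.
move=> ce xe ye nxy; apply/esym/eqP; rewrite eqEcard cards2 ce nxy leqnn andbT.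
by apply/subsetP => z; rewrite !inE => /orP[]/eqP->.
Qed.

Lemma never_both_missed_sym (T : finType) (F : {set {set T}}) :
  symmetric (never_both_missed F).
Proof.
move=> u v; rewrite /never_both_missed eq_sym; congr (_ || _).
by apply: eq_forallb => M; rewrite orbC.
Qed.

(* Gallai's lemma: among the maximum matchings missing t, take one sharing
   as many edges as possible with M; an exchange along one edge of M
   contradicts this choice. *)
Lemma never_both_missed_trans (T : finType) (F : {set {set T}}) :
  F \subset pairs T ->
  (forall v, exists2 M, max_matching F M & v \notin cover M) ->
  transitive (never_both_missed F).
Proof.
move=> sFP avoid t u v Rut Rtv; apply/negPn/negP => nR.
have nut : u != t by apply: contraNneq nR => ->.
have ntv : t != v by apply: contraNneq nR => <-.
move: nR; rewrite /never_both_missed negb_or => /andP[nuv] /forallPn[M].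
rewrite negb_imply negb_or => /and3P[mM uM vM].
move: Rut Rtv; rewrite /never_both_missed (negbTE nut) (negbTE ntv) /=.
move=> /forallP Rut /forallP Rtv.
have [N0 mN0 tN0] := avoid t.
pose Q (N : {set {set T}}) := max_matching F N && (t \notin cover N).
have QN0 : Q N0 by rewrite /Q mN0.
case: (@arg_maxnP _ N0 Q (fun N => #|M :&: N|) QN0) => N /andP[mN tN] maxN.
have tM : t \in cover M by have := Rut M; rewrite mM (negbTE uM).
have uN : u \in cover N by have := Rut N; rewrite mN (negbTE tN) orbF.
have vN : v \in cover N by have := Rtv N; rewrite mN (negbTE tN).
have /and3P[sMF triM /eqP cM] := mM.
have /and3P[sNF triN /eqP cN] := mN.
have cMN : #|cover M| = #|cover N|.
  rewrite !card_cover_matching ?cM ?cN //; exact: subset_trans sFP.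
(* [N] covers [u] and [v], which [M] misses. The covers have equal size, so [M] covers two vertices
   missed by [N], one of which, [x], differs from [t]. *)
have c2 : 2 <= #|cover N :\: cover M|.
  have <- : #|[set u; v]| = 2 by rewrite cards2 nuv.
  apply: subset_leq_card; apply/subsetP => w; rewrite !inE.
  by move=> /orP[]/eqP->; rewrite ?uM ?vM ?uN ?vN.
have {c2} c2 : 2 <= #|cover M :\: cover N|.
  have := cardsID (cover M) (cover N); have := cardsID (cover N) (cover M).
  rewrite setIC; move: c2 cMN; clear; lia.
have [x] : exists x, x \in (cover M :\: cover N) :\ t.
  apply/set0Pn; rewrite -card_gt0.
  have := cardsD1 t (cover M :\: cover N); move: c2; clear; lia.
rewrite !inE => /and3P[nxt xN /bigcupP[e eM xe]].
have ce : #|e| = 2 by have := subsetP (subset_trans sMF sFP) e eM; rewrite inE => /eqP.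
have eN : e \notin N by apply: contra xN => eN; apply: mem_cover eN xe.
(* Otherwise [e |: N] would be a matching larger than the maximum. *)
have [y ye yN] : exists2 y, y \in e & y \in cover N.
  case: (boolP [disjoint e & cover N]) => [de|]; last first.
    by move=> /pred0Pn[y /andP[]]; exists y.
  have : #|e |: N| <= matching_number F.
    apply: leq_matching_number; first by rewrite subUset sub1set (subsetP sMF) ?sNF.
    apply: trivIset_setU1 => // f fN; apply: disjointWr de.
    by apply/subsetP => z; apply: mem_cover.
  by rewrite cardsU1 eN cN add1n ltnn.
have nxy : x != y by apply: contraNneq xN => ->.
have def_e := pair_other ce xe ye nxy.
have /bigcupP[f fN yf] := yN.
have fM : f \notin M.
  apply/negP => fM; have ef := trivIset_mem_eq triM eM fM ye yf.
  by move: eN; rewrite ef fN.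
(* The exchange trades [f], outside [M], for [e] in [M]. It still misses [t], since [x != t] and [y]
   is covered by [N]. *)
pose N' := e |: (N :\ f).
have QN' : Q N'.
  rewrite /Q /max_matching; apply/andP; split; first apply/and3P; first split.
  - rewrite subUset sub1set (subsetP sMF) //=.
    by apply: subset_trans sNF; apply: subsetDl.
  - apply: trivIset_setU1; first by apply: trivIsetS triN; apply: subsetDl.
    move=> g /setD1P[ngf gN]; rewrite def_e disjoint_subset.
    apply/subsetP => z; rewrite !inE => /orP[]/eqP->.
      by apply: contra xN; apply: mem_cover.
    by apply: contra ngf => yg; rewrite (trivIset_mem_eq triN gN fN yg yf).
  - rewrite /N' cardsU1 !inE (negbTE eN) andbF /= -cN.
    by rewrite (cardsD1 f N) fN.
  - apply/bigcupP => -[g /setU1P[->|/setD1P[_ gN] tg]].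
      rewrite def_e !inE => /orP[]/eqP tE; first by rewrite tE eqxx in nxt.
      by rewrite tE yN in tN.
    by move/negP: tN; apply; apply: mem_cover gN tg.
have := maxN _ QN'; apply/negP; rewrite -ltnNge.
have : #|e |: (M :&: N)| <= #|M :&: N'|.
  apply: subset_leq_card; apply/subsetP => g; rewrite !inE.
  move=> /orP[/eqP->|/andP[gM gN]]; first by rewrite eM eqxx.
  rewrite gM gN andbT /=; apply/orP; right.
  by apply: contraNneq fM => <-.
by rewrite cardsU1 inE (negbTE eN) andbF add1n.
Qed.

(** The map [r] sends a vertex to the representative of its class, so the classes are the nonempty
    fibres of [r]. A maximum matching has at least [k./2] edges inside a class of size [k]. *)
Lemma no_unavoidable_vertex_cover (T : finType) (F : {set {set T}}) :
  F \subset pairs T ->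
  (forall v, exists2 M, max_matching F M & v \notin cover M) ->
  exists r : T -> T,
    [/\ forall x, r (r x) = r x,
        \sum_z #|[set x | r x == z]|./2 <= matching_number F
      & forall e, e \in F -> {in e &, forall x y, r x = r y}].
Proof.
move=> sFP avoid; set R := never_both_missed F.
have Rsym : symmetric R := @never_both_missed_sym T F.
have Rtr : transitive R := never_both_missed_trans sFP avoid.
have Rxx : reflexive R by move=> x; rewrite /R /never_both_missed eqxx.
(* The pick depends only on the class of [x] and succeeds by reflexivity, so the default is never
   taken. *)
pose r x := odflt x [pick y | R x y].
have Rr x : R x (r x).
  by rewrite /r; case: pickP => [y|/(_ x)] //=; rewrite Rxx.
have rE x y : R x y -> r x = r y.
  move=> Rxy; rewrite /r.
  have -> : [pick z | R x z] = [pick z | R y z].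
    apply: eq_pick => z /=; apply/idP/idP; apply: Rtr => //.
    by rewrite Rsym.
  by case: pickP => // /(_ y); rewrite Rxx.
have rR x y : r x = r y -> R x y.
  by move=> E; apply: (Rtr (r x)); rewrite ?Rr // E Rsym Rr.
have redge e : e \in F -> {in e &, forall x y, r x = r y}.
  move=> eF x y xe ye; apply: rE; rewrite /R /never_both_missed.
  have [//|nxy] := eqVneq x y.
  apply/forallP => M; apply/implyP => /and3P[sMF tM /eqP cM].
  apply/negPn/negP; rewrite negb_or => /andP[xM yM].
  have ce : #|e| = 2 by have := subsetP sFP e eF; rewrite inE => /eqP.
  have : #|e |: M| <= matching_number F.
    apply: leq_matching_number; first by rewrite subUset sub1set eF.
    apply: trivIset_setU1 => // f fM; rewrite (pair_other ce xe ye nxy).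
    rewrite disjoint_subset; apply/subsetP => z; rewrite !inE => /orP[]/eqP->.
      by apply: contra xM; apply: mem_cover.
    by apply: contra yM; apply: mem_cover.
  rewrite cardsU1 cM; case: (boolP (e \in M)) => [eM|_]; last by rewrite add1n ltnn.
  by move: xM; rewrite (mem_cover eM xe).
exists r; split=> //; first by move=> x; apply/esym/rE/Rr.
have [M /andP[sMF tM] cM] := matching_numberP F.
have mM : max_matching F M by rewrite /max_matching sMF tM cM eqxx.
rewrite -cM.
pose S z := [set x | r x == z].
pose Mz z := [set e in M | e \subset S z].
(* Edges of [M] meeting a class lie inside it, and together they cover all of it but at most one
   vertex. *)
have half_le z : #|S z|./2 <= #|Mz z|.
  have sMzM : Mz z \subset M by apply/subsetP => e; rewrite inE => /andP[].
  have cMz : #|cover (Mz z)| = 2 * #|Mz z|.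
    apply: card_cover_matching; last exact: trivIsetS tM.
    exact: subset_trans (subset_trans sMzM sMF) sFP.
  have h1 : #|S z :&: cover M| <= #|cover (Mz z)|.
    apply: subset_leq_card; apply/subsetP => x; rewrite !inE.
    move=> /andP[/eqP rx /bigcupP[e eM xe]]; apply: (mem_cover _ xe).
    rewrite inE eM; apply/subsetP => y ye; rewrite inE -rx.
    by rewrite (redge e (subsetP sMF e eM) y x).
  have h2 : #|S z :\: cover M| <= 1.
    apply/card_le1P => x; rewrite !inE => /andP[xM /eqP rx] y.
    rewrite !inE; apply/idP/eqP => [/andP[yM /eqP ry]|->]; last by rewrite xM rx eqxx.
    have : R x y by apply: rR; rewrite rx ry.
    rewrite /R /never_both_missed => /orP[/eqP//|/forallP/(_ M)].
    by rewrite mM (negbTE xM) (negbTE yM).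
  have := cardsID (cover M) (S z); move: cMz h1 h2; clear; lia.
apply: (@leq_trans (\sum_z #|Mz z|)); first by apply: leq_sum => z _; apply: half_le.
(* Double counting: an edge is nonempty, hence lies in at most one fibre. *)
have -> : \sum_z #|Mz z| = \sum_z \sum_(e in M) (e \subset S z : nat).
  apply: eq_bigr => z _; rewrite -sum1_card big_mkcond [RHS]big_mkcond /=.
  by apply: eq_bigr => e _; rewrite inE; case: (e \in M); case: (e \subset _).
rewrite exchange_big -sum1_card /=; apply: leq_sum => e eM.
have /card_gt0P[x xe] : 0 < #|e|.
  by have := subsetP sFP e (subsetP sMF e eM); rewrite inE => /eqP->.
rewrite (bigD1 (r x)) //= big1 ?addn0 ?leq_b1 // => z nz.
case: subsetP => // /(_ x xe); rewrite inE eq_sym (negbTE nz) //.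
Qed.

Lemma matching_cover (T : finType) (F : {set {set T}}) :
  F \subset pairs T ->
  exists (U : {set T}) (r : T -> T),
    [/\ forall x, r (r x) = r x,
        #|U| + \sum_z #|[set x | r x == z]|./2 <= matching_number F
      & forall e, e \in F ->
          (exists2 x, x \in e & x \in U) \/ {in e &, forall x y, r x = r y}].
Proof.
have [k] := ubnP (matching_number F); elim: k F => // k IH F ltFk sFP.
have [/forallP avoid|/forallPn[v]] :=
  boolP [forall v, [exists M, max_matching F M && (v \notin cover M)]].
  have [||r [idr wr er]] := @no_unavoidable_vertex_cover T F => //.
    by move=> v; have /existsP[M /andP[]] := avoid v; exists M.
  by exists set0, r; rewrite cards0; split=> // e /er; right.
rewrite negb_exists => /forallP unavoid.
pose F' := [set e in F | v \notin e].
have sF'F : F' \subset F by apply/subsetP => e; rewrite inE => /andP[].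
have ltF' : matching_number F' < matching_number F.
  have [M /andP[sMF' tM] cM] := matching_numberP F'.
  have sMF := subset_trans sMF' sF'F.
  rewrite -cM ltn_neqAle leq_matching_number // andbT.
  (* If [M] had [matching_number F] edges, it would be a maximum matching of [F] missing [v]. The
     drop by one pays for [v] in the new [U]. *)
  have := unavoid M; rewrite /max_matching sMF tM /=.
  apply: contraNneq => ->; rewrite eqxx /=.
  by apply/bigcupP => -[e /(subsetP sMF')]; rewrite inE => /andP[_ /negP].
have [||U [r [idr wr er]]] := IH F'; first by move: ltF' ltFk; clear; lia.
  exact: subset_trans sFP.
exists (v |: U), r; split=> //; first by rewrite cardsU1; move: wr ltF'; clear; lia.
move=> e eF; have [ve|ve] := boolP (v \in e).
  by left; exists v => //; rewrite setU11.
have [|[x xe xU]|] := er e; first by rewrite inE eF.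
  by left; exists x => //; rewrite setU1r.
by right.
Qed.

(** * Containers *)

Lemma bin2D a b : 'C(a + b, 2) = 'C(a, 2) + a * b + 'C(b, 2).
Proof.
elim: a => [|a IHa]; first by rewrite bin0n.
by rewrite addSn !binS !bin1 IHa; nia.
Qed.

Lemma card_pairs_in (T : finType) (B : {set T}) :
  #|[set e in pairs T | e \subset B]| = 'C(#|B|, 2).
Proof.
rewrite -cards_draws; apply: eq_card => e.
by rewrite !inE andbC.
Qed.

Lemma card_pairs_meeting (T : finType) (U : {set T}) :
  #|[set e in pairs T | ~~ [disjoint e & U]]| = 'C(#|U|, 2) + #|U| * (#|T| - #|U|).
Proof.
have cT : #|pairs T| = 'C(#|T|, 2) by rewrite -card_draws.
have := cardsID [set e : {set T} | e \subset ~: U] (pairs T).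
have -> : pairs T :&: [set e : {set T} | e \subset ~: U] =
          [set e in pairs T | e \subset ~: U] by apply/setP => e; rewrite !inE.
have -> : pairs T :\: [set e : {set T} | e \subset ~: U] =
          [set e in pairs T | ~~ [disjoint e & U]].
  by apply/setP => e; rewrite !inE andbC disjoints_subset.
rewrite card_pairs_in cT -(cardsC U) bin2D addKn.
by move: #|_| #|_| #|_| => a b c; lia.
Qed.

Definition container (T : finType) (U : {set T}) (r : T -> T) : {set {set T}} :=
  [set e in pairs T | ~~ [disjoint e & U]] :|:
  [set e in pairs T | [forall x in e, forall y in e, r x == r y]].

Lemma leq_card_bigcup (I T : finType) (A : I -> {set T}) :
  #|\bigcup_i A i| <= \sum_i #|A i|.
Proof.
apply: (big_ind2 (fun (B : {set T}) m => #|B| <= m)); rewrite ?cards0 //.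
move=> B1 m1 B2 m2 h1 h2; apply: leq_trans (leq_add h1 h2).
exact: leq_card_setU.
Qed.

Lemma bin2_double m : 2 * 'C(m, 2) + m = m * m.
Proof.
elim: m => [|m IHm]; first by rewrite bin0n.
by rewrite binS bin1; nia.
Qed.

(** Expresses the pairs inside a part through the half-size that the cover counts; odd [m] gives
    equality. *)
Lemma bin2_half_le m : 'C(m, 2) <= m./2 * (2 * m./2).+1.
Proof.
have := odd_double_half m; have := bin2_double m.
by move: 'C(m, 2) m./2 (odd m) => c a b; case: b; nia.
Qed.

(* Convexity in [u]: the maximum over [0 <= u <= s] is attained at an endpoint. *)
Lemma erdos_gallai_arith n s u A :
  2 * s + 2 <= n -> u + A <= s ->
  'C(u, 2) + u * (n - u) + A * (2 * A).+1
    <= maxn 'C(2 * s + 1, 2) ('C(s, 2) + s * (n - s)).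
Proof.
move=> hn hu; rewrite leq_max; apply/orP.
have := bin2_double u; have := bin2_double s; have := bin2_double (2 * s + 1).
move: 'C(u, 2) 'C(s, 2) 'C(_, 2) => cu cs c2s e2s es eu.
have [t es'] : exists t, s = u + t by exists (s - u); lia.
have [m em] : exists m, n = s + m by exists (n - s); lia.
have hA : A * (2 * A).+1 <= t * (2 * t).+1 by apply: leq_mul; lia.
have -> : n - u = t + m by lia.
have -> : n - s = m by lia.
subst s n.
(* The test says [2 * m <= 3 * u + 6 * t + 3]. With [A] raised to [t], twice the gap to the first
   bound is [u * (3 * u + 6 * t + 3 - 2 * m)], and twice the gap to the second is
   [t * (2 * m - 3 * t - 3)]. *)
have [h|h] := leqP (2 * (u + t + m) + 3 * u) (8 * (u + t) + 3); [left|right].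
  by have := leq_mul (leqnn u) h; nia.
by have := leq_mul (leqnn t) (ltnW h); nia.
Qed.

Lemma card_container (T : finType) (U : {set T}) (r : T -> T) (s : nat) :
  2 * s + 2 <= #|T| -> #|U| + \sum_z #|[set x | r x == z]|./2 <= s ->
  #|container U r| <= maxn 'C(2 * s + 1, 2) ('C(s, 2) + s * (#|T| - s)).
Proof.
move=> hT hw; apply: leq_trans (erdos_gallai_arith hT hw).
apply: leq_trans (leq_card_setU _ _) _.
rewrite card_pairs_meeting leq_add2l.
pose S z := [set x | r x == z]; rewrite -/(S _).
apply: (@leq_trans (\sum_z 'C(#|S z|, 2))).
  under eq_bigr do rewrite -card_pairs_in.
  apply: leq_trans (leq_card_bigcup _); apply: subset_leq_card.
  apply/subsetP => e; rewrite inE => /andP[eP /forall_inP er].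
  have /card_gt0P[x xe] : 0 < #|e| by move: eP; rewrite inE => /eqP->.
  apply/bigcupP; exists (r x) => //; rewrite inE eP.
  apply/subsetP => y ye; rewrite inE eq_sym.
  by have /forall_inP := er x xe; apply.
(* Each half-size is at most their total, so concentrating the total in one part is the worst
   case. *)
rewrite big_distrl /=; apply: leq_sum => z _.
apply: leq_trans (bin2_half_le _) _; rewrite leq_mul2l; apply/orP; right.
by rewrite ltnS leq_mul2l /= (bigD1 z) //= leq_addr.
Qed.

(** * Coding containers by few pairs of vertices *)

Lemma card_small_sets (X : finType) (k : nat) :
  #|[set A : {set X} | #|A| <= k]| <= #|X|.+1 ^ k.
Proof.
(* The value [None] pads the listing of a set with fewer than [k] elements. *)
pose g (t : {ffun 'I_k -> option X}) : {set X} := [set x | Some x \in codom t].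
apply: (@leq_trans #|g @: setT|).
  apply: subset_leq_card; apply/subsetP => A; rewrite inE => cA.
  apply/imsetP; exists [ffun i : 'I_k => nth None (map some (enum A)) i] => //.
  apply/setP => x; rewrite inE; apply/idP/codomP => [xA|[i]].
    have ix : index x (enum A) < #|A| by rewrite cardE index_mem mem_enum.
    exists (Ordinal (leq_trans ix cA)); rewrite ffunE /=.
    by rewrite (nth_map x) -?cardE // nth_index // mem_enum.
  rewrite ffunE => E; have [lt|ge] := ltnP i (size (enum A)).
    by move: E; rewrite (nth_map x) // => -[->]; rewrite -mem_enum mem_nth.
  by move: E; rewrite nth_default ?size_map.
by apply: leq_trans (leq_imset_card _ _) _; rewrite cardsT card_ffun card_option card_ord.
Qed.

Lemma eq_container (T : finType) (U : {set T}) (r1 r2 : T -> T) :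
  r1 =1 r2 -> container U r1 = container U r2.
Proof.
move=> E; congr (_ :|: _); apply/setP => e; rewrite !inE; congr (_ && _).
by apply: eq_forallb => x; congr (_ ==> _); apply: eq_forallb => y; rewrite !E.
Qed.

(* A code lists [U] on the diagonal and the graph of [r] off the diagonal. *)
Definition decode_container (T : finType) (A : {set T * T}) : {set {set T}} :=
  container [set x | (x, x) \in A]
    (fun x => odflt x [pick y | ((x, y) \in A) && (y != x)]).

(** A nonempty fibre of the idempotent [r] contains its own value, a fixed point; the other [k - 1]
    points of a fibre of size [k] number at most [2 * k./2]. *)
Lemma card_nonfixed (T : finType) (r : T -> T) :
  (forall x, r (r x) = r x) ->
  #|[set x | r x != x]| <= 2 * \sum_z #|[set x | r x == z]|./2.
Proof.
move=> idr; rewrite -sum1_card big_distrr /=.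
rewrite (partition_big r predT) //=; apply: leq_sum => z _.
set S := [set x | r x == z].
have [S0|[x0 x0S]] := set_0Vmem S.
  rewrite big1 // => x /andP[_ rx].
  by have : x \in S; [rewrite inE | rewrite S0 inE].
have zS : z \in S by move: x0S; rewrite !inE => /eqP <-; rewrite idr.
have -> : \sum_(i in [set x | r x != x] | r i == z) 1 = #|S :\ z|.
  rewrite -sum1_card; apply: eq_bigl => x; rewrite !inE.
  by case: (r x =P z) => [->|]; rewrite ?andbT ?andbF // eq_sym.
by have := cardsD1 z S; rewrite zS; move: #|_| #|_|; clear; lia.
Qed.

Lemma container_codeP (T : finType) (U : {set T}) (r : T -> T) (s : nat) :
  (forall x, r (r x) = r x) ->
  #|U| + \sum_z #|[set x | r x == z]|./2 <= s ->
  exists2 A : {set T * T}, #|A| <= 2 * s & decode_container A = container U r.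
Proof.
move=> idr hw.
exists ([set (x, x) | x in U] :|: [set (x, r x) | x in [set x | r x != x]]).
  apply: leq_trans (leq_card_setU _ _) _.
  have := leq_imset_card (fun x => (x, x)) (mem U).
  have := leq_imset_card (fun x => (x, r x)) (mem [set x | r x != x]).
  have := card_nonfixed idr; move: hw.
  rewrite -[#|mem U|]/#|U| -[#|mem [set x | _]|]/#|[set x | r x != x]|.
  move: #|_| #|_| #|_| #|_| (\sum_z _); clear; lia.
set A := _ :|: _.
have AE x y : ((x, y) \in A) = ((x == y) && (x \in U)) || ((y == r x) && (y != x)).
  rewrite inE; congr (_ || _).
    apply/imsetP/andP => [[z zU [-> ->]]|[/eqP<- xU]]; [by [] | by exists x].
  apply/imsetP/andP => [[z]|[/eqP-> nx]]; last by exists x; rewrite ?inE.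
  by rewrite inE => nz [-> ->].
have UE : [set x | (x, x) \in A] = U.
  by apply/setP => x; rewrite inE AE eqxx andbF orbF.
rewrite /decode_container UE; apply: eq_container => x.
(* No off-diagonal pair starts at a fixed point of [r], where the default [x] is the right value. *)
case: pickP => [y|/(_ (r x))] /=; rewrite AE.
  by case/andP=> /orP[/andP[/eqP-> _]|/andP[/eqP->]]; rewrite ?eqxx.
by case: (eqVneq (r x) x) => [->//|_]; rewrite eqxx orbT.
Qed.

Lemma container_family (T : finType) (s : nat) :
  2 * s + 2 <= #|T| ->
  exists CC : {set {set {set T}}},
    [/\ #|CC| <= (#|T| * #|T|).+1 ^ (2 * s),
        forall C, C \in CC -> C \subset pairs T,
        forall C, C \in CC ->
          #|C| <= maxn 'C(2 * s + 1, 2) ('C(s, 2) + s * (#|T| - s))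
      & forall F : {set {set T}}, F \subset pairs T -> matching_number F <= s ->
          exists2 C, C \in CC & F \subset C].
Proof.
move=> hT; set m := maxn _ _.
pose K := [set A : {set T * T} | #|A| <= 2 * s].
(* A code need not come from a cover, so decoded graphs with more than [m] edges are discarded. *)
exists [set C in [set decode_container A | A in K] | #|C| <= m]; split.
- apply: (@leq_trans #|[set decode_container A | A in K]|).
    by apply: subset_leq_card; apply/subsetP => C; rewrite inE => /andP[].
  apply: leq_trans (leq_imset_card _ _) _.
  by rewrite -card_prod; apply: card_small_sets.
- move=> C; rewrite inE => /andP[/imsetP[A _ ->] _].
  by apply/subsetP => e; rewrite inE => /orP[]; rewrite inE => /andP[].
- by move=> C; rewrite inE => /andP[].
move=> F sFP nuF; have [U [r [idr wr er]]] := matching_cover sFP.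
have {}wr := leq_trans wr nuF.
have [A cA dA] := container_codeP idr wr.
exists (container U r).
  rewrite inE card_container // andbT; apply/imsetP; exists A; rewrite ?inE //.
apply/subsetP => e eF; have eP := subsetP sFP e eF.
rewrite in_setU; case: (er e eF) => [[x xe xU]|h]; apply/orP; [left|right].
  by rewrite inE eP; apply/pred0Pn; exists x; rewrite /= xe.
rewrite inE eP; apply/forall_inP => x xe; apply/forall_inP => y ye.
by rewrite (h x y).
Qed.

(** * The two extremal graphs *)

Lemma extremal_graph (T : finType) (s : nat) :
  2 * s + 2 <= #|T| ->
  exists C : {set {set T}},
    [/\ C \subset pairs T, matching_number C <= s
      & #|C| = maxn 'C(2 * s + 1, 2) ('C(s, 2) + s * (#|T| - s))].
Proof.
move=> hT.
have exset k : k <= #|T| -> exists B : {set T}, #|B| = k.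
  move=> hk; have : 0 < #|[set B : {set T} | #|B| == k]|.
    by rewrite card_draws bin_gt0.
  by move=> /card_gt0P[B]; rewrite inE => /eqP; exists B.
rewrite /maxn; case: ifP => _.
  have [|U cU] := exset s; first by lia.
  exists [set e in pairs T | ~~ [disjoint e & U]]; split.
  - by apply/subsetP => e; rewrite inE => /andP[].
  - have [M /andP[sM tM] <-] := matching_numberP [set e in pairs T | ~~ [disjoint e & U]].
    (* Every edge of [M] is the block of one of its vertices in [U]. *)
    rewrite -cU; apply: (@leq_trans #|pblock M @: U|); last exact: leq_imset_card.
    apply: subset_leq_card; apply/subsetP => e eM.
    have := subsetP sM e eM; rewrite inE => /andP[_ /pred0Pn[x /andP[xe xU]]].
    by apply/imsetP; exists x => //; rewrite (def_pblock tM eM xe).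
  - by rewrite card_pairs_meeting cU.
have [|B cB] := exset (2 * s + 1); first by lia.
exists [set e in pairs T | e \subset B]; split.
- by apply/subsetP => e; rewrite inE => /andP[].
- have [M /andP[sM tM] <-] := matching_numberP [set e in pairs T | e \subset B].
  have cM : #|cover M| = 2 * #|M|.
    apply: card_cover_matching tM; apply/subsetP => e /(subsetP sM).
    by rewrite inE => /andP[].
  have : #|cover M| <= #|B|.
    apply: subset_leq_card; apply/subsetP => x /bigcupP[e /(subsetP sM)].
    by rewrite inE => /andP[_ /subsetP]; apply.
  by rewrite cB cM; move: #|_|; clear; lia.
- by rewrite card_pairs_in cB.
Qed.

(** * Tail bounds in G(n, p) *)

Import Order.TTheory GRing.Theory Num.Theory.

Local Open Scope ring_scope.

Lemma gnp_weight_ge0 (R : realType) (n : nat) (p : R) (G : {set {set 'I_n}}) :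
  0 <= p <= 1 -> 0 <= gnp_weight p G.
Proof.
move=> /andP[p0 p1]; apply: prodr_ge0 => e _.
by case: ifP => _ //; rewrite subr_ge0.
Qed.

Lemma gnp_probE (R : realType) (n : nat) (p : R) (A : pred {set {set 'I_n}}) :
  gnp_prob p A = \sum_(G in powerset (pairs 'I_n)) gnp_weight p G * (A G)%:R.
Proof.
rewrite /gnp_prob big_mkcondr; apply: eq_bigr => G _.
by case: (A G); rewrite ?mulr1 ?mulr0.
Qed.

Lemma gnp_probC (R : realType) (n : nat) (p : R) (A : pred {set {set 'I_n}}) :
  gnp_prob p A = 1 - gnp_prob p (predC A).
Proof.
apply/eqP; rewrite -subr_eq opprK -(gnp_probT n p) !gnp_probE -big_split /=.
apply/eqP; apply: eq_bigr => G _; rewrite -mulrDr; congr (_ * _).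
by case: (A G); rewrite /= ?addr0 ?add0r.
Qed.

Lemma gnp_prob_leU (R : realType) (n : nat) (p : R) (A B C : pred {set {set 'I_n}}) :
  0 <= p <= 1 ->
  (forall G : {set {set 'I_n}}, G \subset pairs 'I_n -> A G -> B G || C G) ->
  gnp_prob p A <= gnp_prob p B + gnp_prob p C.
Proof.
move=> hp hABC; rewrite !gnp_probE -big_split; apply: ler_sum => G.
rewrite powersetE => /hABC {}hABC /=; rewrite -mulrDr.
apply: ler_wpM2l; first exact: gnp_weight_ge0.
move: hABC; case: (A G) => [/(_ isT)|_]; last by rewrite addr_ge0 ?ler0n.
by case: (B G) => /= [_|->]; rewrite ?lerDl ?lerDr ?ler0n.
Qed.

Lemma gnp_prob_le_sum (R : realType) (n : nat) (p : R) (I : finType) (K : {set I})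
    (A : pred {set {set 'I_n}}) (D : I -> pred {set {set 'I_n}}) :
  0 <= p <= 1 ->
  (forall G : {set {set 'I_n}}, G \subset pairs 'I_n -> A G ->
    exists2 i, i \in K & D i G) ->
  gnp_prob p A <= \sum_(i in K) gnp_prob p (D i).
Proof.
move=> hp hAD; rewrite gnp_probE; under [leRHS]eq_bigr => i _ do rewrite gnp_probE.
rewrite exchange_big; apply: ler_sum => G.
rewrite powersetE => /hAD {}hAD /=; rewrite -mulr_sumr.
apply: ler_wpM2l; first exact: gnp_weight_ge0.
have sum_ge0 (P : pred I) : 0 <= \sum_(i in K | P i) (D i G)%:R :> R.
  by apply: sumr_ge0 => i _; apply: ler0n.
case: (boolP (A G)) hAD => [_ /(_ isT)[i iK Di]|_ _]; last first.
  by apply: sumr_ge0 => i _; apply: ler0n.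
by rewrite (bigD1 i) //= Di lerDl.
Qed.

Lemma gnp_mgf (R : realType) (n : nat) (p b : R) (C : {set {set 'I_n}}) :
  C \subset pairs 'I_n ->
  \sum_(G in powerset (pairs 'I_n)) gnp_weight p G * b ^+ #|G :&: C|
    = (1 - p + p * b) ^+ #|C|.
Proof.
move=> sCP; pose P := pairs 'I_n.
(* [f e] and [g e] are the factors of a present and an absent [e]. Off [P] they are 0 and 1, so only
   subsets of [P] survive in the expanded product. *)
pose f e : R := if e \in P then p * (if e \in C then b else 1) else 0.
pose g e : R := if e \in P then 1 - p else 1.
have -> : (1 - p + p * b) ^+ #|C| = \prod_e (f e + g e).
  rewrite (bigID (mem C)) /= [X in _ = _ * X]big1 ?mulr1.
    rewrite -prodr_const; apply: eq_bigr => e eC.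
    by rewrite /f /g (subsetP sCP e eC) eC addrC.
  move=> e eNC; rewrite /f /g (negbTE eNC); case: ifP => _; last by rewrite add0r.
  by rewrite mulr1 addrC subrK.
rewrite bigA_distr big_mkcond; apply: eq_bigr => G _ /=.
rewrite powersetE; case: ifPn => [sGP|/subsetPn[e eG eNP]]; last first.
  by rewrite (bigD1 e) //= eG /f (negbTE eNP) mul0r.
rewrite /gnp_weight -prodr_const big_mkcond [X in _ * X]big_mkcond -big_split.
apply: eq_bigr => e _ /=; rewrite in_setI /f /g -/P.
case: (boolP (e \in P)) => eP; case: (boolP (e \in G)) => eG //=;
  rewrite ?mulr1 //.
by case/negP: eP; apply: (subsetP sGP).
Qed.

(* Negative [l] gives the lower tail. *)
Lemma gnp_chernoff (R : realType) (n : nat) (p l t : R) (C : {set {set 'I_n}}) :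
  0 <= p <= 1 -> C \subset pairs 'I_n ->
  gnp_prob p (fun G => l * t <= l * #|G :&: C|%:R)
    <= expR (p * (expR l - 1) * #|C|%:R - l * t).
Proof.
move=> hp sCP; have /andP[p0 p1] := hp.
(* Markov: the indicator of the event is at most the exponential of [l * #|G :&: C|%:R - l * t]. *)
apply: (@le_trans _ _ ((1 - p + p * expR l) ^+ #|C| * expR (- (l * t)))).
  rewrite gnp_probE -gnp_mgf // mulr_suml; apply: ler_sum => G _.
  rewrite -mulrA; apply: ler_wpM2l; first exact: gnp_weight_ge0.
  rewrite -expRM_natr -expRD; have [h|_] := boolP (l * t <= _); last exact: expR_ge0.
  by rewrite -[leLHS](expR0 R) ler_expR subr_ge0.
rewrite expRD ler_pM2r ?expR_gt0 // expRM_natr; apply: lerXn2r.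
- by rewrite nnegrE addr_ge0 ?subr_ge0 // mulr_ge0 // expR_ge0.
- by rewrite nnegrE expR_ge0.
- apply: le_trans (expR_ge1Dx _); lra.
Qed.

Lemma gnp_upper_tail (R : realType) (n m : nat) (p eps : R) (C : {set {set 'I_n}}) :
  0 < eps < 1 -> 0 <= p <= 1 -> C \subset pairs 'I_n -> (#|C| <= m)%N ->
  gnp_prob p (fun G => (1 + eps) * p * m%:R <= #|G :&: C|%:R)
    <= expR (- (p * m%:R * eps ^+ 2 / 6)).
Proof.
move=> /andP[e0 e1] hp sCP cC; have /andP[p0 p1] := hp.
(* Chosen so that [1 - l = 2 / (2 + eps)]; then [expR (- l) >= 1 - l] gives [expR l <= 1 + eps / 2],
   and the exponent has the factor [1 / (2 * (2 + eps)) >= 1 / 6]. *)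
pose l := eps / (2 + eps).
have l0 : 0 < l by rewrite divr_gt0 ?addr_gt0.
have le : expR l - 1 <= eps / 2.
  have : (1 + - l) * expR l <= 1.
    rewrite -[leRHS](mulVf (lt0r_neq0 (expR_gt0 l))) -expRN.
    by rewrite ler_pM2r ?expR_gt0 // expR_ge1Dx.
  have -> : 1 + - l = 2 / (2 + eps) by rewrite /l; field; lra.
  rewrite mulrAC ler_pdivrMr ?mul1r; lra.
have -> : gnp_prob p (fun G => (1 + eps) * p * m%:R <= #|G :&: C|%:R) =
    gnp_prob p (fun G => l * ((1 + eps) * p * m%:R) <= l * #|G :&: C|%:R).
  by apply: eq_bigl => G; rewrite ler_pM2l.
apply: le_trans (gnp_chernoff _ _ hp sCP) _; rewrite ler_expR.
have hm : #|C|%:R <= m%:R :> R by rewrite ler_nat.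
have m0 : 0 <= m%:R :> R by rewrite ler0n.
have h1 : p * (expR l - 1) * #|C|%:R <= p * (eps / 2) * m%:R.
  apply: le_trans (_ : p * (eps / 2) * #|C|%:R <= _).
    by rewrite ler_wpM2r // ler_wpM2l.
  by rewrite ler_wpM2l // mulr_ge0 // divr_ge0 // ltW.
apply: le_trans (lerB h1 (lexx _)) _.
have -> : p * (eps / 2) * m%:R - l * ((1 + eps) * p * m%:R) =
    - (p * m%:R * eps ^+ 2 * (2 * (2 + eps))^-1).
  by rewrite /l; field; lra.
rewrite lerN2; apply: ler_wpM2l; first by rewrite !mulr_ge0 // ltW.
by rewrite lef_pV2 ?posrE; lra.
Qed.

Lemma gnp_lower_tail (R : realType) (n : nat) (p eps : R) (C : {set {set 'I_n}}) :
  0 < eps < 1 -> 0 <= p <= 1 -> C \subset pairs 'I_n ->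
  gnp_prob p (fun G => #|G :&: C|%:R <= (1 - eps) * p * #|C|%:R)
    <= expR (- (p * #|C|%:R * eps ^+ 2 / 6)).
Proof.
move=> /andP[e0 e1] hp sCP; have /andP[p0 p1] := hp.
(* Here [expR (eps / 2) >= 1 + eps / 2] bounds [expR l] by [2 / (2 + eps)]. *)
pose l := - (eps / 2).
have l0 : l < 0 by rewrite oppr_lt0 divr_gt0.
have le : expR l - 1 <= - (eps / (2 + eps)).
  have : expR l * (1 + eps / 2) <= 1.
    rewrite -[leRHS](mulVf (lt0r_neq0 (expR_gt0 (eps / 2)))) -expRN.
    by rewrite ler_pM2l ?expR_gt0 // expR_ge1Dx.
  have -> : 1 + eps / 2 = (2 + eps) / 2 by field.
  move=> h; have -> : - (eps / (2 + eps)) = 2 / (2 + eps) - 1 by field; lra.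
  by rewrite lerD2r ler_pdivlMr; lra.
set m : R := #|C|%:R.
have -> : gnp_prob p (fun G => #|G :&: C|%:R <= (1 - eps) * p * m) =
    gnp_prob p (fun G => l * ((1 - eps) * p * m) <= l * #|G :&: C|%:R).
  by apply: eq_bigl => G; rewrite ler_nM2l.
apply: le_trans (gnp_chernoff _ _ hp sCP) _; rewrite ler_expR -/m.
have m0 : 0 <= m by rewrite ler0n.
have h1 : p * (expR l - 1) * m <= p * (- (eps / (2 + eps))) * m.
  by rewrite ler_wpM2r // ler_wpM2l.
apply: le_trans (lerB h1 (lexx _)) _.
have -> : p * (- (eps / (2 + eps))) * m - l * ((1 - eps) * p * m) =
    - (p * m * eps ^+ 2 * ((1 + eps) / (2 * (2 + eps)))).
  by rewrite /l; field; lra.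
rewrite lerN2; apply: ler_wpM2l; first by rewrite !mulr_ge0 // ltW.
by rewrite ler_pdivlMr; lra.
Qed.

(** * From tail bounds to the extremal number of the random graph *)

Lemma max_edges_nu_leP (T : finType) (s : nat) (G : {set {set T}}) :
  exists2 F : {set {set T}},
    (F \subset G) && (matching_number F <= s)%N & #|F| = max_edges_nu_le s G.
Proof.
have p0 : ((set0 : {set {set T}}) \subset G)
    && (matching_number (set0 : {set {set T}}) <= s)%N.
  rewrite sub0set; have [M /andP[sM0 _] <-] := matching_numberP (set0 : {set {set T}}).
  by move: sM0; rewrite subset0 => /eqP->; rewrite cards0.
rewrite /max_edges_nu_le (@bigop.bigmax_eq_arg _ set0
  (fun F : {set {set T}} => (F \subset G) && (matching_number F <= s)%N) _ p0) //.
by case: arg_maxnP => // F pF _; exists F.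
Qed.

Lemma leq_max_edges_nu_le (T : finType) (s : nat) (G C : {set {set T}}) :
  (matching_number C <= s)%N -> (#|G :&: C| <= max_edges_nu_le s G)%N.
Proof.
move=> nuC; rewrite /max_edges_nu_le.
apply: (@bigop.leq_bigmax_cond _
  (fun F : {set {set T}} => (F \subset G) && (matching_number F <= s)%N) (fun F => #|F|)).
rewrite subsetIl; apply: leq_trans nuC.
have [M /andP[sM tM] <-] := matching_numberP (G :&: C).
by apply: leq_matching_number tM; apply: subset_trans sM (subsetIr _ _).
Qed.

(** Since [2 * m >= s * n], the exponent is at least [250 / 12] times [s * ln n], while 7 times
    suffices. *)
Lemma chernoff_exponent (R : realType) (eps p : R) (n s m : nat) :
  0 < eps -> (0 < n)%N -> (s * n <= 2 * m)%N ->
  250 * ln n%:R / (eps ^+ 2 * n%:R) <= p ->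
  expR (- (p * m%:R * eps ^+ 2 / 6)) <= n%:R ^- (7 * s).
Proof.
move=> e0 n0 hm hp.
have n0' : 0 < n%:R :> R by rewrite ltr0n.
have ln0 : 0 <= ln n%:R :> R by rewrite ln_ge0 // ler1n.
have -> : n%:R ^- (7 * s) = expR (- ((7 * s)%:R * ln n%:R)) :> R.
  by rewrite expRN expRM_natl lnK.
rewrite ler_expR lerN2.
have he : 0 < eps ^+ 2 by rewrite exprn_gt0.
have h1 : 250 * ln n%:R <= p * (eps ^+ 2 * n%:R) by rewrite -ler_pdivrMr // mulr_gt0.
have h2 : s%:R * n%:R <= 2 * m%:R :> R by rewrite -!natrM ler_nat.
have p0 : 0 <= p.
  apply: le_trans hp; apply: divr_ge0; apply: mulr_ge0 => //; exact: ltW.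
have h3 : p * eps ^+ 2 * (s%:R * n%:R) <= p * eps ^+ 2 * (2 * m%:R).
  by apply: ler_wpM2l => //; apply: mulr_ge0 => //; apply: ltW.
have s0 : 0 <= s%:R :> R by rewrite ler0n.
have h4 := ler_wpM2l s0 h1.
have h5 := mulr_ge0 s0 ln0.
rewrite natrM; nra.
Qed.

Theorem theorem1p7 (R : realType) (eps p : R) (n s : nat) :
  0 < eps < 1 ->
  (0 < n)%N -> (0 < s)%N -> (2 * s + 2 <= n)%N ->
  0 <= p <= 1 ->
  250 * ln n%:R / (eps ^+ 2 * n%:R) <= p ->
  let M : R := (maxn 'C(2 * s + 1, 2) ('C(s, 2) + s * (n - s)))%:R in
  1 - 2 * n%:R ^- s <=
    gnp_prob p (fun G : {set {set 'I_n}} =>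
      let X : R := (max_edges_nu_le s G)%:R in
      (1 - eps) * p * M <= X <= (1 + eps) * p * M).
Proof.
move=> he n0 s0 hn hp hp250; cbv zeta.
rewrite gnp_probC lerD2l lerN2.
have hT : (2 * s + 2 <= #|'I_n|)%N by rewrite card_ord.
have [C0 [sC0 nuC0]] := extremal_graph hT.
have [CC [cCC sCC mCC coverCC]] := container_family hT.
rewrite card_ord in cCC mCC *; set m := maxn _ _ in mCC * => cC0.
have hm : (s * n <= 2 * m)%N.
  have : ('C(s, 2) + s * (n - s) <= m)%N by apply: leq_maxr.
  by move: hn; clear; nia.
have tail : expR (- (p * m%:R * eps ^+ 2 / 6)) <= n%:R ^- (7 * s).
  by apply: chernoff_exponent => //; case/andP: he.
pose low (G : {set {set 'I_n}}) := #|G :&: C0|%:R <= (1 - eps) * p * #|C0|%:R.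
pose high (C G : {set {set 'I_n}}) := (1 + eps) * p * m%:R <= #|G :&: C|%:R.
pose up (G : {set {set 'I_n}}) := (1 + eps) * p * m%:R < (max_edges_nu_le s G)%:R.
have n1 : 1 <= n%:R :> R by rewrite ler1n.
have nX_gt0 k : 0 < n%:R ^+ k :> R by rewrite exprn_gt0 // ltr0n.
have p_low : gnp_prob p low <= n%:R ^- s.
  apply: le_trans (gnp_lower_tail he hp sC0) _; rewrite cC0.
  apply: le_trans tail _.
  by rewrite lef_pV2 ?posrE // ler_weXn2l //; move: s0; clear; lia.
have p_up : gnp_prob p up <= n%:R ^- s.
  (* Union bound: an optimal [F] lies in some container [C], so [G :&: C] has at least as many edges
     as [F]. *)
  apply: (@le_trans _ _ (\sum_(C in CC) gnp_prob p (high C))).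
    apply: gnp_prob_le_sum => // G sGP upG.
    have [F /andP[sFG nuF] cF] := max_edges_nu_leP s G.
    have [C CCC sFC] := coverCC F (subset_trans sFG sGP) nuF.
    exists C => //; rewrite /high; apply: le_trans (ltW upG) _.
    by rewrite ler_nat -cF subset_leq_card // subsetI sFG.
  apply: (@le_trans _ _ (\sum_(C in CC) n%:R ^- (7 * s))).
    apply: ler_sum => C CCC; apply: le_trans tail.
    by apply: gnp_upper_tail => //; [apply: sCC | apply: mCC].
  rewrite sumr_const -[leLHS]mulr_natl.
  have h : #|CC|%:R <= n%:R ^+ (6 * s) :> R.
    rewrite -natrX ler_nat; apply: leq_trans cCC _.
    (* As [n >= 4], the base [n * n + 1] of the container count is at most [n ^ 3]. *)
    have -> : (6 * s = 3 * (2 * s))%N by lia.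
    rewrite [leqRHS]expnM leq_exp2r; last by move: s0; clear; lia.
    have : (4 <= n)%N by move: s0 hn; clear; lia.
    by rewrite !expnS expn0; clear; nia.
  apply: le_trans (ler_wpM2r _ h) _; first by rewrite invr_ge0 ltW.
  have -> : (7 * s = 6 * s + s)%N by lia.
  by rewrite exprD invfM mulrA mulfV ?mul1r // lt0r_neq0.
have -> : 2 * n%:R ^- s = n%:R ^- s + n%:R ^- s :> R by ring.
apply: le_trans (lerD p_low p_up).
(* If [X] is too small, then so is [G :&: C0], which competes for the maximum. *)
apply: gnp_prob_leU => // G _ /=; rewrite negb_and -!ltNge => /orP[lo|hi].
  apply/orP; left; rewrite /low cC0; apply: le_trans (ltW lo).
  by rewrite ler_nat leq_max_edges_nu_le.
by apply/orP; right.
Qed.
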